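(* Let $X$ and $Y$ be real Hilbert spaces and let $I$ be either $[0,T]$ with $T>0$ or $\mathbb{R}_+=[0,+\infty)$. Assume: (K) $K\subset X$ is a nonempty closed convex cone. (A) $A:X\to X$ satisfies, for some constants $m_A>0$, $L_A>0$: $(Au-Av,u-v)_X\ge m_A\|u-v\|_X^2$ and $\|Au-Av\|_X\le L_A\|u-v\|_X$ for all $u,v\in X$. (R) $\mathcal{R}:C(I;X)\to C(I;Y)$ and for every compact set $\mathcal{J}\subset I$ there exist $l^{\mathcal R}_{\mathcal J}>0$, $L^{\mathcal R}_{\mathcal J}>0$ with $\|\mathcal{R}u_1(t)-\mathcal{R}u_2(t)\|_Y\le l^{\mathcal R}_{\mathcal J}\|u_1(t)-u_2(t)\|_X+L^{\mathcal R}_{\mathcal J}\int_0^t\|u_1(s)-u_2(s)\|_X\,ds$ for all $u_1,u_2\in C(I;X)$, $t\in\mathcal J$. (S) $\mathcal{S}:C(I;X)\to C(I;X)$ and for every compact set $\mathcal{J}\subset I$ there exist $l^{\mathcal S}_{\mathcal J}>0$, $L^{\mathcal S}_{\mathcal J}>0$ with $\|\mathcal{S}u_1(t)-\mathcal{S}u_2(t)\|_X\le l^{\mathcal S}_{\mathcal J}\|u_1(t)-u_2(t)\|_X+L^{\mathcal S}_{\mathcal J}\int_0^t\|u_1(s)-u_2(s)\|_X\,ds$ for all $u_1,u_2\in C(I;X)$, $t\in\mathcal J$. (j) $j:Y\times K\to\mathbb{R}$ is such that (a) for every $\eta\in Y$, $j(\eta,\cdot):K\to\mathbb{R}$ is convex,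 positively homogeneous and Lipschitz continuous; (b) there is $\alpha_j\ge 0$ with $j(\eta_1,v_2)-j(\eta_1,v_1)+j(\eta_2,v_1)-j(\eta_2,v_2)\le\alpha_j\|\eta_1-\eta_2\|_Y\|v_1-v_2\|_X$ for all $\eta_1,\eta_2\in Y$, $v_1,v_2\in K$. (f) $f\in C(I;X)$. Assume moreover that for every compact set $\mathcal J\subset I$, $(\alpha_j+1)(l^{\mathcal R}_{\mathcal J}+l^{\mathcal S}_{\mathcal J})<m_A$. Then there exists a unique function $u:I\to X$ such that $$-u(t)\in \mathrm{N}_{C(\mathcal{R}u(t),t)}\big(Au(t)+\mathcal{S}u(t)\big)\quad\forall\,t\in I,$$ and this solution satisfies $u\in C(I;K)$.
   Context: $C(I;Z)$ denotes the space of continuous functions $I\to Z$, and $\mathcal{R}u(t)$ means $(\mathcal{R}u)(t)$. For a nonempty closed convex set $D\subset X$, the normal cone is $\mathrm{N}_D(x)=\{\xi\in X:(\xi,v-x)_X\le 0\ \forall v\in D\}$ if $x\in D$ and $\mathrm{N}_D(x)=\emptyset$ if $x\notin D$. Given $j$, define $J:Y\times X\to(-\infty,+\infty]$ by $J(\eta,v)=j(\eta,v)$ if $v\in K$ and $J(\eta,v)=+\infty$ if $v\notin K$; set $C(\eta)=\{\xi\in X: J(\eta,v)\ge(\xi,v)_X\ \forall v\in X\}$ (the convex subdifferential of $J(\eta,\cdot)$ at $0_X$) and $C(\eta,t)=f(t)-C(\eta)$ for $\eta\in Y$, $t\in I$. *)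

(* Defs.v *)
From HB Require Import structures.
From mathcomp Require Import all_boot all_order all_algebra.
From mathcomp Require Import all_classical all_reals all_analysis.
Set Implicit Arguments. Unset Strict Implicit. Unset Printing Implicit Defensive.
Import Order.TTheory GRing.Theory Num.Theory.
Import numFieldNormedType.Exports.
Local Open Scope classical_set_scope.
Local Open Scope ring_scope.

(* A real Hilbert space structure on a complete normed space X:
   a symmetric bilinear form whose induced norm is the norm of X. *)
Record inner_product (R : realType) (X : completeNormedModType R) := InnerProduct {
  ip :> X -> X -> R;
  ip_sym : forall u v, ip u v = ip v u;
  ip_linl : forall (a : R) u v w, ip (a *: u + v) w = a * ip u w + ip v w;
  ip_norm : forall u, ip u u = `|u| ^+ 2 }.

Section Defs.
Context (R : realType) (X : completeNormedModType R).

Definition closed_convex_cone (K : set X) :=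
  [/\ K !=set0, closed K,
      (forall (a : R) u v, 0 <= a <= 1 -> K u -> K v -> K (a *: u + (1 - a) *: v))
    & (forall (a : R) u, 0 < a -> K u -> K (a *: u))].

Definition normal_cone (ipX : inner_product X) (D : set X) (x : X) : set X :=
  [set xi | D x /\ forall v, D v -> ipX xi (v - x) <= 0].

Context (Y : completeNormedModType R).

Definition Jfun (K : set X) (j : Y -> X -> R) (eta : Y) (v : X) : \bar R :=
  if `[< K v >] then (j eta v)%:E else +oo%E.

(* C(eta): the convex subdifferential of J(eta, .) at 0 *)
Definition Cset (ipX : inner_product X) (K : set X) (j : Y -> X -> R) (eta : Y)
  : set X := [set xi | forall v, ((ipX xi v)%:E <= Jfun K j eta v)%E].

Definition Cset_t (ipX : inner_product X) (K : set X) (j : Y -> X -> R)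
  (f : R -> X) (eta : Y) (t : R) : set X :=
  [set f t - xi | xi in Cset ipX K j eta].

End Defs.

Definition int0 (R : realType) (g : R -> R) (t : R) : \bar R :=
  (\int[lebesgue_measure]_(s in `[0%R, t]) (g s)%:E)%E.

(* Main.v *)
Require Import Defs.
From HB Require Import structures.
From mathcomp Require Import all_boot all_order all_algebra ring lra.
From mathcomp Require Import all_classical all_reals all_analysis.
From mathcomp Require Import measurable_realfun.
Import Order.TTheory GRing.Theory Num.Theory.
Import numFieldNormedType.Exports.
Local Open Scope classical_set_scope.
Local Open Scope ring_scope.

Set Implicit Arguments.
Unset Strict Implicit.

(** The inclusion says that [f t - S u t - A (u t)] is a subgradient at [u t] of [j (R u t)]
    restricted to the cone [K], i.e. that [u t] solves an elliptic variational inequality on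
    [K]: the normal cone to the set of linear minorants of a sublinear function inverts its
    subdifferential.  With the values [R u t] and [S u t] frozen, this inequality has a unique
    solution, which depends on them in a Lipschitz way with constants [alphaj / mA] and
    [1 / mA].  Solutions of the problem are thus the fixed points of an almost
    history-dependent operator with instantaneous constant [(alphaj * lR + lS) / mA < 1].  On
    each [[0, b]] contained in [I] it is a contraction for an exponentially weighted sup norm;
    the Picard iterates do not depend on [b], so they converge to the unique fixed point on
    all of [I]. *)

Section ConvexityAndLipschitz.
Context (R : realType) (X Y : normedModType R) (K : set X).

Lemma convex_setP : convex_set K <->
  forall (a : R) u v, 0 <= a <= 1 -> K u -> K v -> K (a *: u + (1 - a) *: v).
Proof.
split=> [cvxK a u v /andP[a0 a1] Ku Kv | cvxK u v t /set_mem Ku /set_mem Kv].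
  by have /set_mem := cvxK u v (Itv01 a0 a1) (mem_set Ku) (mem_set Kv).
by apply/mem_set/cvxK => //; rewrite ge0 le1.
Qed.

Lemma convex_functionP (phi : X -> R) : convex_function K phi <->
  forall (a : R) u v, 0 <= a <= 1 -> K u -> K v ->
    phi (a *: u + (1 - a) *: v) <= a * phi u + (1 - a) * phi v.
Proof.
split=> [cvx_phi a u v /andP[a0 a1] Ku Kv | cvx_phi t u v /set_mem Ku /set_mem Kv].
  exact: (cvx_phi (Itv01 a0 a1) u v (mem_set Ku) (mem_set Kv)).
by apply: cvx_phi => //; rewrite ge0 le1.
Qed.

Lemma klipschitzP (k : R) (f : X -> Y) : k.-lipschitz_K f <->
  forall u v, K u -> K v -> `|f u - f v| <= k * `|u - v|.
Proof.
split=> [lip u v Ku Kv | lip [u v] [Ku Kv]]; last exact: lip.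
exact: (lip (u, v)).
Qed.

Lemma lipschitzP (f : X -> Y) :
  [lipschitz f x | x in K] <-> exists k : R, k.-lipschitz_K f.
Proof.
have [->|/set0P[u Ku]] := eqVneq K set0.
  by split=> [_|_]; [exists 0 => -[? ?] [] | exact: lipschitz_set0].
have KK_proper : ProperFilter (globally (K `*` K)).
  exact: (@globally_properfilter _ _ (u, u)).
exact: ex_dom_bound.
Qed.

End ConvexityAndLipschitz.

Section CauchyMajorant.
Context (R : realType) (X : completeNormedModType R).
Context (x_ : nat -> X) (e_ : nat -> R).
Hypothesis e_cvg0 : e_ @ \oo --> 0.
Hypothesis x_dist : forall n k, `|x_ (n + k)%N - x_ n| <= e_ n.

Lemma cauchy_majorant_cvg : cvg (x_ @ \oo).
Proof.
apply/cauchy_cvgP/cauchy_exP => eps eps0.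
have [N _ eN] : \forall n \near \oo, `|e_ n| < eps by exact: cvgr0_norm_lt.
exists (x_ N), N => // n /= Nn; rewrite -ball_normE /= distrC -(subnKC Nn).
by apply: le_lt_trans (x_dist _ _) _; apply: le_lt_trans (ler_norm _) (eN N _) => /=.
Qed.

Lemma cauchy_majorant_lim n : `|lim (x_ @ \oo) - x_ n| <= e_ n.
Proof.
apply: (@cvgr_to_le _ \oo _ _ (fun k => `|x_ (n + k)%N - x_ n|)); last exact: nearW.
apply: cvg_norm; apply: cvgB; last exact: cvg_cst.
exact: cvg_comp (cvg_addnl n) cauchy_majorant_cvg.
Qed.

End CauchyMajorant.

Section WithinContinuous.
Context (R : realType) (T : topologicalType) (D : set T).

Lemma within_continuous_dominated (X Y Z : normedModType R) (a c : R)
    (x : T -> X) (y : T -> Y) (z : T -> Z) :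
  {within D, continuous x} -> {within D, continuous y} ->
  (forall s t, D s -> D t -> `|z s - z t| <= a * `|x s - x t| + c * `|y s - y t|) ->
  {within D, continuous z}.
Proof.
move=> /subspace_continuousP x_cont /subspace_continuousP y_cont z_dom.
apply/subspace_continuousP => t Dt; apply/subr_cvg0/norm_cvg0P.
have dist_cvg0 (V : normedModType R) (v : T -> V) :
    v @ within D (nbhs t) --> v t -> `|v s - v t| @[s --> within D (nbhs t)] --> 0.
  by move=> v_cont; apply/norm_cvg0P/subr_cvg0.
apply: (@squeeze_cvgr _ _ _ _ (cst 0) (fun s => a * `|x s - x t| + c * `|y s - y t|)).
- by near=> s; rewrite normr_ge0 z_dom//; near: s; exact: withinT.
- exact: cvg_cst.
- rewrite -[X in _ --> X]addr0 -[in X in _ --> X + _](mulr0 a) -[in X in _ --> _ + X](mulr0 c).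
  by apply: cvgD; apply: cvgMl_tmp; apply: dist_cvg0; [exact: x_cont|exact: y_cont].
Unshelve. all: by end_near. Qed.

Lemma within_continuous_bounded (X : normedModType R) (u : T -> X) :
  compact D -> {within D, continuous u} -> exists c, forall t, D t -> `|u t| <= c.
Proof.
move=> Dcompact u_cont.
have [M [_ boundM]] := compact_bounded (continuous_compact u_cont Dcompact).
exists (`|M| + 1) => t Dt; apply: boundM; last by exists t.
by rewrite (le_lt_trans (ler_norm M))// ltrDl.
Qed.

End WithinContinuous.

Lemma dominated_cvg_uniform (R : realType) (T : choiceType) (X : normedModType R)
    (D : set T) (u_ : nat -> T -> X) (u : T -> X) (e_ : nat -> R) :
  e_ @ \oo --> 0 -> (forall n t, D t -> `|u t - u_ n t| <= e_ n) ->
  {uniform D, u_ @ \oo --> u}.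
Proof.
move=> e_cvg0 u_dom P /uniform_nbhs[E [+ EP]]; rewrite -entourage_ballE => -[eps eps0 epsE].
have [N _ eN] : \forall n \near \oo, `|e_ n| < eps by exact: cvgr0_norm_lt.
exists N => // n Nn; apply: EP => t Dt; apply: epsE; rewrite /= -ball_normE /=.
apply: le_lt_trans (u_dom n t Dt) _; exact: le_lt_trans (ler_norm _) (eN n Nn).
Qed.

Section InnerProduct.
Context (R : realType) (X : completeNormedModType R) (ipX : inner_product X).
Implicit Types (u v w z : X) (a : R).

Lemma ipDl u v w : ipX (u + v) w = ipX u w + ipX v w.
Proof. by have := ip_linl ipX 1 u v w; rewrite scale1r mul1r. Qed.

Lemma ip0l w : ipX 0 w = 0.
Proof. by apply: (@addrI _ (ipX 0 w)); rewrite -ipDl !addr0. Qed.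

Lemma ipZl a u w : ipX (a *: u) w = a * ipX u w.
Proof. by have := ip_linl ipX a u 0 w; rewrite addr0 ip0l addr0. Qed.

Lemma ipNl u w : ipX (- u) w = - ipX u w.
Proof. by rewrite -scaleN1r ipZl mulN1r. Qed.

Lemma ipDr u v w : ipX w (u + v) = ipX w u + ipX w v.
Proof. by rewrite !(ip_sym ipX w) ipDl. Qed.

Lemma ipZr a u w : ipX w (a *: u) = a * ipX w u.
Proof. by rewrite !(ip_sym ipX w) ipZl. Qed.

Lemma ipNr u w : ipX w (- u) = - ipX w u.
Proof. by rewrite !(ip_sym ipX w) ipNl. Qed.

Definition ip_bilinE := (ipDl, ipDr, ipNl, ipNr, ipZl, ipZr).

Lemma sqr_normB u v : `|u - v| ^+ 2 = `|u| ^+ 2 - 2 * ipX u v + `|v| ^+ 2.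
Proof. by rewrite -!(ip_norm ipX) !ip_bilinE (ip_sym ipX v u); ring. Qed.

Lemma sqr_norm_conv a u v z : `|a *: u + (1 - a) *: v - z| ^+ 2 =
  a * `|u - z| ^+ 2 + (1 - a) * `|v - z| ^+ 2 - a * (1 - a) * `|u - v| ^+ 2.
Proof.
rewrite -!(ip_norm ipX) !ip_bilinE (ip_sym ipX v u) (ip_sym ipX z u) (ip_sym ipX z v).
by ring.
Qed.

Lemma ip_cauchy_schwarz u v : ipX u v <= `|u| * `|v|.
Proof.
have [->|u_neq0] := eqVneq u 0; first by rewrite ip0l normr0 mul0r.
have [->|v_neq0] := eqVneq v 0; first by rewrite ip_sym ip0l normr0 mulr0.
have uv_gt0 : 0 < `|u| * `|v| by rewrite mulr_gt0 ?normr_gt0.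
have := sqr_ge0 `| `|v| *: u - `|u| *: v |.
rewrite sqr_normB !normrZ !normr_id !ip_bilinE => sq_ge0.
rewrite -subr_ge0 -(pmulr_rge0 _ (mulr_gt0 (ltr0Sn R 1) uv_gt0)).
by apply: le_trans sq_ge0 _; rewrite le_eqVlt; apply/orP; left; apply/eqP; ring.
Qed.

Definition strongly_monotone (m : R) (B : X -> X) :=
  forall u v, m * `|u - v| ^+ 2 <= ipX (B u - B v) (u - v).

Lemma forward_step_contraction B (m L : R) :
  0 < m -> 0 < L -> strongly_monotone m B -> L.-lipschitz B ->
  exists r k : R, [/\ 0 < r, 0 <= k < 1 & k.-lipschitz (fun u => u - r *: B u)].
Proof.
move=> m_gt0 L_gt0 B_mono /klipschitzP B_lip.
pose r := m / L ^+ 2; have r_gt0 : 0 < r by rewrite divr_gt0// exprn_gt0.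
exists r, (Num.sqrt (1 - r * m)); split=> //.
  rewrite sqrtr_ge0 -sqrtr1 ltr_sqrt ?ltr01// sqrtr1.
  by rewrite ltrBlDr ltrDl mulr_gt0.
apply/klipschitzP => u v _ _.
have rL2 : r * L ^+ 2 = m by rewrite /r divfK// gt_eqF// exprn_gt0.
have Bsq_le : r ^+ 2 * `|B u - B v| ^+ 2 <= r * m * `|u - v| ^+ 2.
  rewrite -[in leRHS]rL2 (_ : _ * _ * _ = r ^+ 2 * (L * `|u - v|) ^+ 2); last by ring.
  by rewrite ler_wpM2l ?sqr_ge0// lerXn2r ?nnegrE ?mulr_ge0 ?(ltW L_gt0) ?B_lip.
have step_sq : `|u - r *: B u - (v - r *: B v)| ^+ 2 <= `|u - v| ^+ 2 * (1 - r * m).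
  rewrite (opprD v) addrACA -opprD -scalerBr sqr_normB normrZ exprMn (gtr0_norm r_gt0).
  rewrite ipZr (ip_sym ipX (u - v)).
  by have := B_mono u v; rewrite -(ler_pM2l r_gt0); lra.
rewrite -[leLHS]normr_id -sqrtr_sqr mulrC -[X in X * _]normr_id -[X in X * _]sqrtr_sqr.
by rewrite -sqrtrM ?sqr_ge0// ler_wsqrtr.
Qed.

End InnerProduct.

Lemma ler_add_small_multiples (R : realType) (x y d : R) :
  (forall a, 0 < a <= 1 -> x <= y + a * d) -> x <= y.
Proof.
move=> x_le; apply/ler_addgt0Pr => eps eps_gt0.
have d1_gt0 : 0 < `|d| + 1 by rewrite ltr_wpDl.
pose a := Num.min 1 (eps / (`|d| + 1)).
have a_gt0 : 0 < a by rewrite lt_min ltr01 divr_gt0.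
have ad_le : a * (`|d| + 1) <= eps by rewrite -ler_pdivlMr// ge_min lexx orbT.
apply: le_trans (x_le a _) _; first by rewrite a_gt0 ge_min lexx.
rewrite lerD2l; apply: le_trans ad_le; rewrite ler_pM2l//.
by rewrite (le_trans (ler_norm d))// lerDl.
Qed.

Section UniformlyConvexMinimization.
Context (R : realType) (X : completeNormedModType R) (K : set X) (F : X -> R) (m : R).
Hypothesis m_gt0 : 0 < m.
Hypothesis K_neq0 : K !=set0.
Hypothesis K_closed : closed K.
Hypothesis F_cont : {within K, continuous F}.
Hypothesis F_lbound : has_lbound (F @` K).
Hypothesis F_midpoint : forall u v, K u -> K v ->
  exists2 w, K w & F w <= (F u + F v) / 2 - m * `|u - v| ^+ 2.

Lemma sqr_dist_le_excess u v (e : R) : K u -> K v ->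
  F u <= inf (F @` K) + e -> F v <= inf (F @` K) + e -> m * `|u - v| ^+ 2 <= e.
Proof.
move=> Ku Kv Fu_le Fv_le; have [w Kw Fw_le] := F_midpoint Ku Kv.
have : inf (F @` K) <= F w by apply: ge_inf => //; exists w.
lra.
Qed.

Theorem uniformly_convex_minimizer : exists2 p, K p & forall v, K v -> F p <= F v.
Proof.
have F_has_inf : has_inf (F @` K) by split=> //; exact: image_nonempty.
have /choice[u u_min] : forall n : nat, exists v, K v /\ F v <= inf (F @` K) + harmonic n.
  move=> n; have [_ [v Kv <-] Fv_lt] := inf_adherent (harmonic_gt0 n) F_has_inf.
  by exists v; split; [|exact: ltW].
have Ku n : K (u n) := (u_min n).1.
have dist_cvg0 : Num.sqrt (harmonic n / m) @[n --> \oo] --> 0.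
  rewrite -[X in _ --> X]sqrtr0 -(mul0r m^-1).
  apply: (@cvg_comp _ _ _ (fun n => harmonic n / m) Num.sqrt _ (nbhs (0 / m))).
    by apply: cvgMr_tmp; exact: cvg_harmonic.
  exact: sqrt_continuous.
have u_cvg : u @ \oo --> lim (u @ \oo).
  apply: (cauchy_majorant_cvg dist_cvg0) => n k.
  rewrite -[leLHS]normr_id -sqrtr_sqr ler_wsqrtr// ler_pdivlMr// mulrC.
  apply: sqr_dist_le_excess (Ku _) (Ku _) _ (u_min n).2.
  apply: le_trans (u_min _).2 _; rewrite lerD2l.
  by rewrite lef_pV2 ?posrE ?ltr0n// ler_nat ltnS leq_addr.
set p := lim (u @ \oo) in u_cvg.
have Kp : K p by apply: (closed_cvg (F := \oo) (u_ := u) K) => //; exact: nearW.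
exists p => // v Kv; apply: (@le_trans _ _ (inf (F @` K))); last first.
  by apply: ge_inf => //; exists v.
have Fu_cvg : F (u n) @[n --> \oo] --> F p.
  move/subspace_continuousP : F_cont => /(_ p Kp); apply: cvg_comp.
  by move=> A /u_cvg[N _ KA]; exists N => // n Nn; exact: KA Nn (Ku n).
have := ler_cvg_to Fu_cvg (cvgD (cvg_cst (inf (F @` K))) (@cvg_harmonic R)).
by rewrite addr0; apply; apply: nearW => n; exact: (u_min n).2.
Qed.

End UniformlyConvexMinimization.

Section Subdifferential.
Context (R : realType) (X : completeNormedModType R) (ipX : inner_product X).
Context (K : set X).
Implicit Types (phi : X -> R) (u v z xi : X).

(* Subdifferential at [u] of the function equal to [phi] on [K] and to [+oo] elsewhere. *)
Definition subdifferential phi u : set X :=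
  [set xi | K u /\ forall v, K v -> ipX xi (v - u) <= phi v - phi u].

Lemma subdifferential_cross_le phi1 phi2 u1 u2 xi1 xi2 :
  subdifferential phi1 u1 xi1 -> subdifferential phi2 u2 xi2 ->
  ipX (xi1 - xi2) (u2 - u1) <= phi1 u2 - phi1 u1 + phi2 u1 - phi2 u2.
Proof.
move=> [Ku1 sub1] [Ku2 sub2]; have := sub1 _ Ku2; have := sub2 _ Ku1.
rewrite !ip_bilinE; lra.
Qed.

Hypothesis K_neq0 : K !=set0.
Hypothesis K_closed : closed K.
Hypothesis K_convex : convex_set K.
Context (phi : X -> R).
Hypothesis phi_convex : convex_function K phi.
Hypothesis phi_lipschitz : [lipschitz phi x | x in K].

Definition proximal_functional (r : R) z v := 2^-1 * `|v - z| ^+ 2 + r * phi v.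

Lemma proximal_functional_conv (r a : R) z u v : 0 <= r -> 0 <= a <= 1 -> K u -> K v ->
  proximal_functional r z (a *: u + (1 - a) *: v) <=
  a * proximal_functional r z u + (1 - a) * proximal_functional r z v
    - a * (1 - a) / 2 * `|u - v| ^+ 2.
Proof.
move=> r_ge0 a01 Ku Kv; rewrite /proximal_functional (sqr_norm_conv ipX).
have := ler_wpM2l r_ge0 ((convex_functionP _ _).1 phi_convex _ _ _ a01 Ku Kv).
lra.
Qed.

Lemma proximal_functional_lbound (r : R) z : 0 <= r ->
  has_lbound (proximal_functional r z @` K).
Proof.
move=> r_ge0; have [L /klipschitzP phi_lip] := (lipschitzP _ _).1 phi_lipschitz.
have [v0 Kv0] := K_neq0.
exists (r * phi v0 - r * `|L| * `|z - v0| - 2^-1 * (r * `|L|) ^+ 2) => _ [v Kv <-].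
rewrite /proximal_functional.
have phi_ge : phi v0 - phi v <= `|L| * (`|v - z| + `|z - v0|).
  apply: le_trans (ler_norm _) (le_trans (phi_lip _ _ Kv0 Kv) _).
  apply: le_trans (ler_wpM2r (normr_ge0 _) (ler_norm L)) _.
  by rewrite distrC ler_wpM2l// ler_distD.
have := ler_wpM2l r_ge0 phi_ge; have := sqr_ge0 (`|v - z| - r * `|L|); lra.
Qed.

Lemma proximal_functional_cont (r : R) z :
  {within K, continuous (proximal_functional r z)}.
Proof.
have [L /klipschitzP phi_lip] := (lipschitzP _ _).1 phi_lipschitz.
have id_cont : {within K, continuous (@id X)}.
  by apply: continuous_subspaceT => ?; exact: cvg_id.
have phi_cont : {within K, continuous phi}.
  apply: (within_continuous_dominated (a := L) (c := 0) id_cont id_cont) => v w Kv Kw.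
  by rewrite mul0r addr0 phi_lip.
move=> v; apply: cvgD; last by apply: cvgMl_tmp; exact: phi_cont.
apply: cvgMl_tmp; under eq_fun do rewrite expr2; rewrite expr2.
have norm_cont : `|w - z| @[w --> (v : subspace K)] --> `|v - z|.
  by apply: cvg_norm; apply: cvgB; [exact: id_cont|exact: cvg_cst].
exact: cvgM.
Qed.

Lemma subdifferential_proximal_minimizer (r : R) z p : 0 < r -> K p ->
  (forall v, K v -> proximal_functional r z p <= proximal_functional r z v) ->
  subdifferential phi p (r^-1 *: (z - p)).
Proof.
move=> r_gt0 Kp p_min; split=> // v Kv.
have conv_le (a : R) : 0 < a <= 1 -> 2^-1 * `|v - p| ^+ 2 <=
    proximal_functional r z v - proximal_functional r z p + a * (2^-1 * `|v - p| ^+ 2).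
  move=> /andP[a_gt0 a_le1]; have a01 : 0 <= a <= 1 by rewrite ltW.
  have Kconv := (convex_setP _).1 K_convex _ _ _ a01 Kv Kp.
  rewrite -(ler_pM2l a_gt0).
  have := le_trans (p_min _ Kconv) (proximal_functional_conv z (ltW r_gt0) a01 Kv Kp).
  lra.
rewrite ipZl -(ler_pM2l r_gt0) mulrA divff ?gt_eqF// mul1r.
have := ler_add_small_multiples conv_le; rewrite /proximal_functional.
have -> : v - z = (v - p) - (z - p) by rewrite opprB addrA subrK.
by rewrite (sqr_normB ipX (v - p)) (ip_sym ipX (v - p)) (distrC p z); lra.
Qed.

Theorem prox_exists (r : R) z : 0 < r ->
  exists p, subdifferential phi p (r^-1 *: (z - p)).
Proof.
move=> r_gt0.
have half01 : 0 <= (2^-1 : R) <= 1 by lra.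
have [||u v Ku Kv|p Kp p_min] := @uniformly_convex_minimizer _ _ K (proximal_functional r z)
    8^-1 _ K_neq0 K_closed (@proximal_functional_cont r z).
- by rewrite invr_gt0.
- exact/proximal_functional_lbound/ltW.
- exists (2^-1 *: u + (1 - 2^-1) *: v).
    exact: (convex_setP _).1 K_convex _ _ _ half01 Ku Kv.
  have := proximal_functional_conv z (ltW r_gt0) half01 Ku Kv; lra.
- by exists p; exact: subdifferential_proximal_minimizer.
Qed.

End Subdifferential.

Section VariationalInequality.
Context (R : realType) (X : completeNormedModType R) (ipX : inner_product X).
Context (K : set X).
Implicit Types (phi : X -> R) (B : X -> X).

Lemma vi_stability phi1 phi2 B (m c : R) g1 g2 u1 u2 :
  strongly_monotone ipX m B ->
  subdifferential ipX K phi1 u1 (g1 - B u1) ->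
  subdifferential ipX K phi2 u2 (g2 - B u2) ->
  0 <= c -> phi1 u2 - phi1 u1 + phi2 u1 - phi2 u2 <= c * `|u1 - u2| ->
  m * `|u1 - u2| <= `|g1 - g2| + c.
Proof.
move=> B_mono sub1 sub2 c_ge0 cross_le.
have [->|dist_neq0] := eqVneq `|u1 - u2| 0; first by rewrite mulr0 addr_ge0.
have dist_gt0 : 0 < `|u1 - u2| by rewrite lt_neqAle eq_sym dist_neq0 normr_ge0.
rewrite -(ler_pM2r dist_gt0) -mulrA -expr2 mulrDl.
have := B_mono u1 u2; have := subdifferential_cross_le sub1 sub2.
have := ip_cauchy_schwarz ipX (g1 - g2) (u1 - u2).
rewrite !ip_bilinE; lra.
Qed.

Lemma vi_unique phi B (m : R) g u1 u2 : 0 < m -> strongly_monotone ipX m B ->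
  subdifferential ipX K phi u1 (g - B u1) -> subdifferential ipX K phi u2 (g - B u2) ->
  u1 = u2.
Proof.
move=> m_gt0 B_mono sub1 sub2; have := vi_stability B_mono sub1 sub2 (lexx 0).
rewrite mul0r subrr normr0 addr0 pmulr_rle0// normr_le0 subr_eq0 => dist_le0.
by apply/eqP/dist_le0; lra.
Qed.

Lemma prox_nonexpansive phi (r : R) z1 z2 p1 p2 : 0 < r ->
  subdifferential ipX K phi p1 (r^-1 *: (z1 - p1)) ->
  subdifferential ipX K phi p2 (r^-1 *: (z2 - p2)) ->
  `|p1 - p2| <= `|z1 - z2|.
Proof.
move=> r_gt0; rewrite !scalerBr => sub1 sub2.
have scale_mono : strongly_monotone ipX r^-1 ( *:%R r^-1).
  by move=> u v; rewrite -scalerBr ipZl ip_norm.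
have := vi_stability scale_mono sub1 sub2 (lexx 0).
rewrite mul0r addr0 -scalerBr normrZ gtr0_norm ?invr_gt0// ler_pM2l ?invr_gt0//.
by apply; lra.
Qed.

Lemma lipschitz_fixed_point (k : R) (F : X -> X) :
  0 <= k < 1 -> k.-lipschitz F -> exists p, F p = p.
Proof.
move=> /andP[k_ge0 k_lt1] F_lip.
have F_fun : set_fun [set: X] [set: X] F by [].
pose F_pack : {fun [set: X] >-> [set: X]} := HB.pack F (isFun.Build _ _ _ _ F F_fun).
have [|//||p _ pE] := @banach_fixed_point R X setT F_pack.
- by exists (NngNum k_ge0).
- by exists 0.
- by exists p; rewrite [RHS]pE.
Qed.

(* [u] solves the inequality iff it is a fixed point of the forward-backward step
   [u |-> prox (u - r *: B u + r *: g)], a contraction for a suitable [r]. *)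
Theorem vi_exists phi B (m L : R) g :
  K !=set0 -> closed K -> convex_set K ->
  convex_function K phi -> [lipschitz phi x | x in K] ->
  0 < m -> 0 < L -> strongly_monotone ipX m B -> L.-lipschitz B ->
  exists u, subdifferential ipX K phi u (g - B u).
Proof.
move=> K_neq0 K_closed K_convex phi_convex phi_lip m_gt0 L_gt0 B_mono B_lip.
have [r [k [r_gt0 k01 /klipschitzP step_lip]]] :=
  forward_step_contraction m_gt0 L_gt0 B_mono B_lip.
have /choice[prox proxP] z :=
  prox_exists ipX K_neq0 K_closed K_convex phi_convex phi_lip z r_gt0.
have [|u uE] := @lipschitz_fixed_point k (fun u => prox (u - r *: B u + r *: g)) k01.
  apply/klipschitzP => u v _ _.
  apply: le_trans (prox_nonexpansive r_gt0 (proxP _) (proxP _)) _.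
  by rewrite opprD addrACA subrr addr0; exact: step_lip.
exists u; have := proxP (u - r *: B u + r *: g); rewrite [prox _]uE.
suff -> : u - r *: B u + r *: g - u = r *: (g - B u).
  by rewrite scalerA mulVf ?gt_eqF// scale1r.
by rewrite addrAC (addrAC u) subrr add0r addrC -scalerBr.
Qed.

End VariationalInequality.

Definition cross_lipschitz (R : realType) (X Y : normedModType R) (K : set X) (alpha : R)
    (j : Y -> X -> R) :=
  forall eta1 eta2 v1 v2, K v1 -> K v2 ->
    j eta1 v2 - j eta1 v1 + j eta2 v1 - j eta2 v2 <=
      alpha * `|eta1 - eta2| * `|v1 - v2|.

Lemma vi_parameter_stability (R : realType) (X Y : completeNormedModType R)
    (ipX : inner_product X) (K : set X) (A : X -> X) (j : Y -> X -> R) (m alpha : R)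
    eta1 eta2 g1 g2 u1 u2 :
  strongly_monotone ipX m A -> 0 <= alpha -> cross_lipschitz K alpha j ->
  subdifferential ipX K (j eta1) u1 (g1 - A u1) ->
  subdifferential ipX K (j eta2) u2 (g2 - A u2) ->
  m * `|u1 - u2| <= alpha * `|eta1 - eta2| + `|g1 - g2|.
Proof.
move=> A_mono alpha_ge0 j_cross sub1 sub2.
rewrite [leRHS]addrC; apply: (vi_stability A_mono sub1 sub2); first by rewrite mulr_ge0.
by apply: j_cross; [case: sub1|case: sub2].
Qed.

Definition positively_homogeneous (R : realType) (X : normedModType R) (K : set X)
    (phi : X -> R) :=
  forall a v, 0 < a -> K v -> phi (a *: v) = a * phi v.

Section LinearMinorants.
Context (R : realType) (X : completeNormedModType R) (ipX : inner_product X).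
Context (K : set X) (phi : X -> R).

Definition linear_minorants : set X := [set xi | forall v, K v -> ipX xi v <= phi v].

Lemma subdifferential_homogeneousP u xi :
  (forall (a : R) v, 0 < a -> K v -> K (a *: v)) ->
  positively_homogeneous K phi ->
  subdifferential ipX K phi u xi <-> [/\ K u, linear_minorants xi & ipX xi u = phi u].
Proof.
move=> K_cone phi_hom; split=> [[Ku sub]|[Ku xi_le xi_eq]]; last first.
  by split=> // v Kv; rewrite !ip_bilinE xi_eq lerB// xi_le.
have xi_eq : ipX xi u = phi u.
  have half_gt0 : 0 < (2^-1 : R) by lra.
  have := sub _ (K_cone _ _ (ltr0Sn R 1) Ku); have := sub _ (K_cone _ _ half_gt0 Ku).
  by rewrite !phi_hom// !ip_bilinE; lra.
split=> // v Kv; have := sub v Kv.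
by rewrite !ip_bilinE xi_eq lerD2r.
Qed.

(* Maximality of [xi] against [u], tested with the residual of the proximal point [p] of
   [xi + u] (Moreau's decomposition), forces [u = p]. *)
Theorem normal_cone_linear_minorantsP u xi :
  closed_convex_cone K -> convex_function K phi -> positively_homogeneous K phi ->
  [lipschitz phi x | x in K] ->
  normal_cone ipX linear_minorants xi u <-> subdifferential ipX K phi u xi.
Proof.
move=> [K_neq0 K_closed /convex_setP K_convex K_cone] phi_convex phi_hom phi_lip.
have subP := subdifferential_homogeneousP _ _ K_cone phi_hom.
split=> [[xi_le xi_max]|/subP[Ku xi_le xi_eq]]; last first.
  split=> // zeta zeta_le; rewrite (ip_sym ipX u) ipDl ipNl xi_eq subr_le0.
  exact: (zeta_le u Ku).
have [p] := prox_exists ipX K_neq0 K_closed K_convex phi_convex phi_lip (xi + u) ltr01.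
rewrite invr1 scale1r => p_sub; have [Kp q_le q_eq] := (subP _ _).1 p_sub.
suff up : u = p by move: p_sub; rewrite -up addrK.
apply/eqP; rewrite -subr_eq0 -normr_eq0 -sqrf_eq0 eq_le sqr_ge0 andbT -(ip_norm ipX).
move: (xi_le _ Kp) (xi_max _ q_le) q_eq.
rewrite !ip_bilinE (ip_sym ipX u xi) (ip_sym ipX p u); lra.
Qed.

End LinearMinorants.

Lemma CsetE (R : realType) (X Y : completeNormedModType R) (ipX : inner_product X)
    (K : set X) (j : Y -> X -> R) (eta : Y) :
  Cset ipX K j eta = linear_minorants ipX K (j eta).
Proof.
apply/seteqP; split=> xi minor v; last first.
  by rewrite /Jfun; case: asboolP => [/minor|_]; rewrite ?lee_fin// leey.
by move=> Kv; have := minor v; rewrite /Jfun asboolT// lee_fin.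
Qed.

Lemma normal_cone_reflection (R : realType) (X : completeNormedModType R)
    (ipX : inner_product X) (D : set X) (a x u : X) :
  normal_cone ipX [set a - xi | xi in D] x (- u) <-> normal_cone ipX D (a - x) u.
Proof.
have reflectE xi : ipX (- u) (a - xi - x) = ipX u (xi - (a - x)).
  by rewrite ipNl -ipNr !opprB addrCA.
split=> [[[xi Dxi xE] normal]|[Dax normal]]; split.
- by rewrite -xE subKr.
- by move=> zeta Dzeta; rewrite -reflectE; apply: normal; exists zeta.
- by exists (a - x); rewrite ?subKr.
- by move=> _ [xi Dxi <-]; rewrite reflectE; exact: normal.
Qed.

Lemma normal_cone_Cset_tP (R : realType) (X Y : completeNormedModType R)
    (ipX : inner_product X) (K : set X) (j : Y -> X -> R) (f : R -> X) (eta : Y) (t : R)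
    (u w w' : X) :
  closed_convex_cone K -> convex_function K (j eta) -> positively_homogeneous K (j eta) ->
  [lipschitz j eta v | v in K] ->
  normal_cone ipX (Cset_t ipX K j f eta t) (w + w') (- u) <->
  subdifferential ipX K (j eta) u (f t - w' - w).
Proof.
move=> K_cone j_convex j_hom j_lip; rewrite -addrA -opprD (addrC w').
rewrite /Cset_t CsetE; apply: iff_trans (normal_cone_reflection _ _ _ _ _) _.
exact: normal_cone_linear_minorantsP.
Qed.

Section ExponentialIntegral.
Context (R : realType).

Lemma continuous_expRM (beta : R) : continuous (fun s => expR (beta * s)).
Proof.
move=> s; apply: (@continuous_comp _ _ _ ( *%R beta) expR); first exact: mulrl_continuous.
exact: continuous_expR.
Qed.

Lemma int0_expRM (beta t : R) : beta != 0 -> 0 <= t ->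
  int0 (fun s => expR (beta * s)) t = ((expR (beta * t) - 1) / beta)%:E.
Proof.
move=> beta_neq0; rewrite le_eqVlt => /predU1P[<-|t_gt0]; rewrite /int0.
  by rewrite set_itv1 integral_set1 mulr0 expR0 subrr mul0r.
pose F s := expR (beta * s) / beta.
have F_derive (s : R) : is_derive s (1 : R) F (expR (beta * s)).
  rewrite /F; apply: is_derive_eq; rewrite /GRing.scale /= !(mulr1, mulr0, addr0, add0r).
  by field.
have F_cont : continuous F.
  by move=> s; apply: cvgMr_tmp; exact: continuous_expRM.
rewrite (@continuous_FTC2 R _ F 0 t)//.
- by rewrite -EFinB /F mulr0 expR0 -mulrBl.
- exact/continuous_subspaceT/continuous_expRM.
- split=> [s _||]; first by have [] := F_derive s.
    by apply: cvg_at_right_filter; exact: F_cont.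
  by apply: cvg_at_left_filter; exact: F_cont.
- by move=> s _; rewrite derive1E; have [] := F_derive s.
Qed.

Lemma int0_le_expRM (g : R -> R) (c beta t : R) :
  {within `[0, t], continuous g} -> 0 < beta -> 0 <= t ->
  (forall s, 0 <= s <= t -> 0 <= g s <= c * expR (beta * s)) ->
  (int0 g t <= (c / beta * expR (beta * t))%:E)%E.
Proof.
move=> g_cont beta_gt0 t_ge0 g_le.
have c_ge0 : 0 <= c.
  have /andP[g0_ge0 /(le_trans g0_ge0)] : 0 <= g 0 <= c * expR (beta * 0).
    by apply: g_le; rewrite lexx.
  by rewrite pmulr_lge0 ?expR_gt0.
have cont_measurable (h : R -> R) : {within `[0, t], continuous h} ->
    measurable_fun (`[0, t] : set R) (fun s => (h s)%:E).
  by move=> h_cont; apply/measurable_EFinP; exact: subspace_continuous_measurable_fun.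
apply: (@le_trans _ _ (c%:E * int0 (fun s => expR (beta * s)) t)%E); last first.
  rewrite int0_expRM ?gt_eqF// -EFinM lee_fin -mulrA ler_wpM2l//.
  by rewrite mulrC ler_pM2l ?invr_gt0// gerBl.
have exp_measurable : measurable_fun (`[0, t] : set R) (fun s => (expR (beta * s))%:E).
  by apply: cont_measurable; apply: continuous_subspaceT; exact: continuous_expRM.
rewrite /int0 -ge0_integralZl//.
apply: ge0_le_integral => //.
- by move=> s st; rewrite lee_fin; case/andP: (g_le s st).
- exact: cont_measurable.
- exact: measurable_funeM.
- by move=> s st; rewrite lee_fin; case/andP: (g_le s st).
Qed.

End ExponentialIntegral.

Section BieleckiDistance.
Context (R : realType) (X : normedModType R) (b beta : R).
Implicit Types (c : R) (u v w : R -> X).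

(* The distance [sup_(0 <= t <= b) |u t - v t| / expR (beta * t)] is at most [c]. *)
Definition bielecki_le c u v :=
  forall t, 0 <= t <= b -> `|u t - v t| <= c * expR (beta * t).

Lemma bielecki_leC c u v : bielecki_le c u v -> bielecki_le c v u.
Proof. by move=> uv t tb; rewrite distrC; exact: uv. Qed.

Lemma bielecki_le_trans c1 c2 u v w :
  bielecki_le c1 u v -> bielecki_le c2 v w -> bielecki_le (c1 + c2) u w.
Proof.
move=> uv vw t tb; rewrite mulrDl (le_trans (ler_distD (v t) _ _))// lerD//.
  exact: uv.
exact: vw.
Qed.

Lemma bielecki_le_cvg0 (c_ : nat -> R) u v : c_ @ \oo --> 0 ->
  (forall n, bielecki_le (c_ n) u v) -> forall t, 0 <= t <= b -> u t = v t.
Proof.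
move=> c_cvg0 uv t tb; apply/eqP; rewrite -subr_eq0 -normr_le0.
have : c_ n * expR (beta * t) @[n --> \oo] --> 0 * expR (beta * t) by exact: cvgMr_tmp.
rewrite mul0r => /cvgr_to_ge; apply.
by apply: nearW => n; exact: uv.
Qed.

Lemma bielecki_le_uniform c u v t : 0 <= beta -> bielecki_le c u v ->
  0 <= t <= b -> `|u t - v t| <= c * expR (beta * b).
Proof.
move=> beta_ge0 uv tb; apply: le_trans (uv t tb) _.
have c_ge0 : 0 <= c by rewrite -(pmulr_lge0 _ (expR_gt0 (beta * t))) (le_trans _ (uv t tb)).
by case/andP: tb => _ t_le_b; rewrite ler_wpM2l// ler_expR ler_wpM2l.
Qed.

Lemma bielecki_le_continuous u v : 0 <= beta ->
  {within `[0, b], continuous u} -> {within `[0, b], continuous v} ->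
  exists c, bielecki_le c u v.
Proof.
move=> beta_ge0 u_cont v_cont.
have [c uv_le] := within_continuous_bounded (@segment_compact R 0 b)
  (within_continuousB u_cont v_cont).
exists c => t tb; have uv_le_c := uv_le t tb.
apply: (le_trans uv_le_c); rewrite ler_peMr//.
  exact: le_trans (normr_ge0 _) uv_le_c.
by rewrite -expR0 ler_expR mulr_ge0//; case/andP: tb.
Qed.

End BieleckiDistance.

Section HistoryDependentOperators.
Context (R : realType).

Definition initial_segment (I : set R) :=
  forall t, I t -> 0 <= t /\ `[0, t] `<=` I.

Lemma initial_segment_itv (T : R) : initial_segment `[0, T].
Proof.
move=> t; rewrite /= in_itv/= => /andP[t_ge0 t_le]; split=> // s.
by rewrite /= !in_itv/= => /andP[-> /le_trans->].
Qed.

Lemma initial_segment_itvcy : initial_segment `[0, +oo[.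
Proof.
move=> t; rewrite /= in_itv/= andbT; split=> // s.
by rewrite /= !in_itv/= => /andP[->].
Qed.

Context (I : set R).

Definition preserves_continuity (X Y : topologicalType) (S : (R -> X) -> R -> Y) :=
  forall u, {within I, continuous u} -> {within I, continuous (S u)}.

Hypothesis I_initial : initial_segment I.

Lemma within_continuous_initial_segment (X : topologicalType) (u : R -> X) :
  (forall b, I b -> {within `[0, b], continuous u}) -> {within I, continuous u}.
Proof.
move=> u_cont; apply/subspace_continuousP => x Ix.
have [b [Ib x_le_b near_le_b]] :
    exists b, [/\ I b, x <= b & \forall s \near within I (nbhs x), s <= b].
  have [[b [Ib x_lt_b]]|x_max] := pselect (exists b, I b /\ x < b).
    exists b; split=> //; first exact: ltW.
    near=> s; apply: ltW; near: s; apply: cvg_within; exact: lt_nbhsl.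
  exists x; split=> //; near=> s; rewrite leNgt; apply/negP => x_lt_s.
  by apply: x_max; exists s; split=> //; near: s; exact: withinT.
have b_cont : u @ within `[0, b] (nbhs x) --> u x.
  have /subspace_continuousP := u_cont b Ib; apply.
  by rewrite /= in_itv/= x_le_b (I_initial Ix).1.
apply: cvg_trans b_cont; apply: cvg_app => V V_near.
apply: (filterS2 (F := nbhs x)) near_le_b V_near => s s_le_b sV Is; apply: sV.
by rewrite /= in_itv/= (I_initial Is).1 s_le_b.
Unshelve. all: by end_near. Qed.

Definition almost_history_dependent (X Y : normedModType R) (J : set R) (l L : R)
    (S : (R -> X) -> R -> Y) :=
  forall u v, {within I, continuous u} -> {within I, continuous v} ->
  forall t, J t -> (`|S u t - S v t|%:E <=
    (l * `|u t - v t|)%:E + L%:E * int0 (fun s => `|u s - v s|)%R t)%E.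

Lemma almost_history_dependent_bielecki (X Y : normedModType R) (b l L beta c : R)
    (S : (R -> X) -> R -> Y) u v :
  I b -> 0 <= l -> 0 <= L -> 0 < beta -> almost_history_dependent `[0, b] l L S ->
  {within I, continuous u} -> {within I, continuous v} ->
  bielecki_le b beta c u v -> bielecki_le b beta ((l + L / beta) * c) (S u) (S v).
Proof.
move=> Ib l_ge0 L_ge0 beta_gt0 S_hist u_cont v_cont uv t tb; have /andP[t_ge0 t_le] := tb.
have It : I t by apply: (I_initial Ib).2; rewrite /= in_itv.
have int_le : (int0 (fun s => `|u s - v s|)%R t <= (c / beta * expR (beta * t))%:E)%E.
  apply: int0_le_expRM => // [|s /andP[s_ge0 s_le]].
    have diff_cont := within_continuousB u_cont v_cont.
    move=> s; apply: cvg_norm.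
    exact: (continuous_subspaceW (I_initial It).2 diff_cont).
  by rewrite normr_ge0 uv// s_ge0 (le_trans s_le).
rewrite -lee_fin; apply: le_trans (S_hist _ _ u_cont v_cont t tb) _.
have -> : ((l + L / beta) * c * expR (beta * t))%:E =
   ((l * (c * expR (beta * t)))%:E + L%:E * (c / beta * expR (beta * t))%:E)%E.
  by rewrite -EFinM -EFinD; congr (_%:E); ring.
by rewrite leeD ?lee_wpmul2l ?lee_fin// ler_wpM2l// uv.
Qed.

Lemma almost_history_dependent_dominated (X Y Z W : normedModType R) (J : set R)
    (a c lR LR lS LS : R) (P : (R -> X) -> R -> Y) (Q : (R -> X) -> R -> Z)
    (S : (R -> X) -> R -> W) :
  0 <= a -> 0 <= c -> 0 <= LR -> 0 <= LS ->
  almost_history_dependent J lR LR P -> almost_history_dependent J lS LS Q ->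
  (forall u v t, J t ->
     `|S u t - S v t| <= a * `|P u t - P v t| + c * `|Q u t - Q v t|) ->
  almost_history_dependent J (a * lR + c * lS) (a * LR + c * LS) S.
Proof.
move=> a_ge0 c_ge0 LR_ge0 LS_ge0 P_hist Q_hist S_dom u v u_cont v_cont t Jt.
set i := int0 _ t.
have scale_hist (k l L d : R) : (k%:E * ((l * d)%:E + L%:E * i) =
    (k * l * d)%:E + (k * L)%:E * i)%E.
  by rewrite muleDr ?fin_num_adde_defr// muleA -!EFinM mulrA.
have -> : (((a * lR + c * lS) * `|u t - v t|)%:E + (a * LR + c * LS)%:E * i =
    a%:E * ((lR * `|u t - v t|)%:E + LR%:E * i) +
    c%:E * ((lS * `|u t - v t|)%:E + LS%:E * i))%E.
  rewrite !scale_hist mulrDl !EFinD ge0_muleDl ?lee_fin ?mulr_ge0//.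
  by rewrite addeACA.
apply: (@le_trans _ _ (a%:E * `|P u t - P v t|%:E + c%:E * `|Q u t - Q v t|%:E)%E).
  by rewrite -!EFinM -EFinD lee_fin S_dom.
by rewrite leeD// lee_wpmul2l ?lee_fin//; [exact: P_hist|exact: Q_hist].
Qed.

End HistoryDependentOperators.

Section BieleckiContraction.
Context (R : realType) (X : completeNormedModType R) (I : set R) (Lam : (R -> X) -> R -> X).

Definition bielecki_contraction (b beta r : R) := [/\ 0 <= beta, 0 <= r < 1 &
  forall c u v, {within I, continuous u} -> {within I, continuous v} ->
    bielecki_le b beta c u v -> bielecki_le b beta (r * c) (Lam u) (Lam v)].

Hypothesis I_initial : initial_segment I.
Hypothesis Lam_cont : preserves_continuity I Lam.
Hypothesis Lam_contraction :
  forall b, I b -> exists beta r, bielecki_contraction b beta r.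

Let geometric_cvg0 (a r : R) : 0 <= r < 1 -> a * r ^+ n @[n --> \oo] --> 0.
Proof. by move=> /andP[r_ge0 r_lt1]; apply: cvg_geometric; rewrite ger0_norm. Qed.

Let continuous_upto b (u : R -> X) :
  I b -> {within I, continuous u} -> {within `[0, b], continuous u}.
Proof. by move=> Ib; apply: continuous_subspaceW; exact: (I_initial Ib).2. Qed.

Let in_upto b t : I b -> 0 <= t <= b -> I t.
Proof. by move=> Ib tb; apply: (I_initial Ib).2; rewrite /= in_itv. Qed.

Definition picard (n : nat) : R -> X := iter n Lam (cst 0).

Lemma picard_continuous n : {within I, continuous (picard n)}.
Proof.
elim: n => [|n IHn]; last exact: Lam_cont.
by apply: continuous_subspaceT => t; exact: cvg_cst.
Qed.

Lemma picard_bielecki_le b beta r : I b -> bielecki_contraction b beta r ->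
  exists M, forall n k, bielecki_le b beta (M * r ^+ n) (picard (n + k)) (picard n).
Proof.
move=> Ib [beta_ge0 /andP[r_ge0 r_lt1] Lam_le].
have [c first_step] := bielecki_le_continuous beta_ge0
  (continuous_upto Ib (@picard_continuous 1%N)) (continuous_upto Ib (@picard_continuous 0%N)).
have r1_gt0 : 0 < 1 - r by rewrite subr_gt0.
exists (c / (1 - r)); elim=> [|n IHn] k; last first.
  rewrite exprS mulrCA.
  by apply: (Lam_le _ (picard (n + k))); [exact: picard_continuous..|exact: IHn].
rewrite expr0 mulr1 add0n; elim: k => [|k IHk].
  move=> t tb; rewrite subrr normr0 mulr_ge0 ?expR_ge0// divr_ge0 ?(ltW r1_gt0)//.
  by rewrite -(pmulr_lge0 _ (expR_gt0 (beta * t))) (le_trans _ (first_step t tb)).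
have -> : c / (1 - r) = r * (c / (1 - r)) + c by field; rewrite gt_eqF.
apply: bielecki_le_trans first_step.
by apply: (Lam_le _ (picard k) (picard 0)); [exact: picard_continuous..|exact: IHk].
Qed.

Definition picard_limit (t : R) : X := lim (picard n t @[n --> \oo]).

Lemma picard_limit_bielecki_le b beta r : I b -> bielecki_contraction b beta r ->
  exists M, forall n, bielecki_le b beta (M * r ^+ n) picard_limit (picard n).
Proof.
move=> Ib Lam_contr; have [_ r01 _] := Lam_contr.
have [M picard_le] := picard_bielecki_le Ib Lam_contr.
exists M => n t tb.
rewrite mulrAC; apply: (cauchy_majorant_lim (geometric_cvg0 _ r01)) => m k.
by rewrite mulrAC; exact: picard_le.
Qed.

Lemma picard_limit_continuous : {within I, continuous picard_limit}.
Proof.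
apply: within_continuous_initial_segment => // b Ib.
have [beta [r Lam_contr]] := Lam_contraction Ib.
have [M limit_le] := picard_limit_bielecki_le Ib Lam_contr.
have [beta_ge0 r01 _] := Lam_contr.
apply: (@uniform_limit_continuous_subspace _ _ _ (picard @ \oo)).
  by exists 0 => // n _; apply: (continuous_upto Ib); exact: picard_continuous.
apply: (dominated_cvg_uniform (geometric_cvg0 (M * expR (beta * b)) r01)) => n t tb.
by rewrite mulrAC; exact: bielecki_le_uniform (limit_le n) tb.
Qed.

Lemma picard_limit_fixed t : I t -> Lam picard_limit t = picard_limit t.
Proof.
move=> It; have [beta [r Lam_contr]] := Lam_contraction It.
have [M limit_le] := picard_limit_bielecki_le It Lam_contr.
have [beta_ge0 r01 Lam_le] := Lam_contr.
apply: (bielecki_le_cvg0 (geometric_cvg0 (2 * r * M) r01)) => [n|].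
  have -> : 2 * r * M * r ^+ n = r * (M * r ^+ n) + M * r ^+ n.+1 by rewrite exprS; ring.
  apply: bielecki_le_trans (bielecki_leC (limit_le n.+1)).
  by apply: Lam_le; [exact: picard_limit_continuous|exact: picard_continuous|exact: limit_le].
by rewrite lexx (I_initial It).1.
Qed.

Lemma bielecki_contraction_unique u v :
  {within I, continuous u} -> {within I, continuous v} ->
  (forall t, I t -> Lam u t = u t) -> (forall t, I t -> Lam v t = v t) ->
  forall t, I t -> u t = v t.
Proof.
move=> u_cont v_cont u_fixed v_fixed b Ib.
have [beta [r [beta_ge0 r01 Lam_le]]] := Lam_contraction Ib.
have [c uv_le] := bielecki_le_continuous beta_ge0
  (continuous_upto Ib u_cont) (continuous_upto Ib v_cont).
apply: (bielecki_le_cvg0 (geometric_cvg0 c r01)) => [n|].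
  elim: n => [|n IHn]; first by rewrite expr0 mulr1; exact: uv_le.
  move=> t tb; have It := in_upto Ib tb.
  rewrite exprS mulrCA -(u_fixed t It) -(v_fixed t It).
  exact: (Lam_le _ _ _ u_cont v_cont IHn).
by rewrite lexx (I_initial Ib).1.
Qed.

End BieleckiContraction.

Lemma almost_history_dependent_contraction (R : realType) (X : completeNormedModType R)
    (I : set R) (Lam : (R -> X) -> R -> X) (b l L : R) :
  initial_segment I -> I b -> 0 <= l < 1 -> 0 <= L ->
  almost_history_dependent I `[0, b] l L Lam ->
  exists beta r, bielecki_contraction I Lam b beta r.
Proof.
move=> I_initial Ib /andP[l_ge0 l_lt1] L_ge0 Lam_hist.
have [beta [beta_gt0 r_lt1]] : exists beta : R, 0 < beta /\ l + L / beta < 1.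
  have l1_gt0 : 0 < 1 - l by rewrite subr_gt0.
  have L1_gt0 : 0 < L + 1 by rewrite ltr_wpDl.
  exists ((L + 1) / (1 - l)); split; first exact: divr_gt0.
  by rewrite -ltrBrDl invf_div mulrCA gtr_pMr// ltr_pdivrMr// mul1r ltrDl.
exists beta, (l + L / beta); split; first exact: ltW.
  by rewrite r_lt1 andbT addr_ge0// divr_ge0// ltW.
by move=> c u v; exact: almost_history_dependent_bielecki.
Qed.

Theorem history_dependent_fixed_point (R : realType) (X : completeNormedModType R)
    (I : set R) (Lam : (R -> X) -> R -> X) :
  initial_segment I -> preserves_continuity I Lam ->
  (forall b, I b -> exists l L : R,
    [/\ 0 <= l < 1, 0 <= L & almost_history_dependent I `[0, b] l L Lam]) ->
  exists u, [/\ {within I, continuous u}, (forall t, I t -> Lam u t = u t) &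
    forall v, {within I, continuous v} -> (forall t, I t -> Lam v t = v t) ->
      forall t, I t -> v t = u t].
Proof.
move=> I_initial Lam_cont Lam_hist.
have Lam_contraction b : I b -> exists beta r, bielecki_contraction I Lam b beta r.
  move=> Ib; have [l [L [l01 L_ge0 hist]]] := Lam_hist b Ib.
  exact: almost_history_dependent_contraction hist.
have limit_cont := picard_limit_continuous I_initial Lam_cont Lam_contraction.
have limit_fixed := picard_limit_fixed I_initial Lam_cont Lam_contraction.
exists (picard_limit Lam); split=> // v v_cont v_fixed.
exact: (bielecki_contraction_unique I_initial Lam_contraction v_cont limit_cont).
Qed.

Section HistoryDependentVariationalInequality.
Context (R : realType) (X Y : completeNormedModType R) (ipX : inner_product X).
Context (I : set R) (K : set X) (A : X -> X) (j : Y -> X -> R) (f : R -> X).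
Context (Rop : (R -> X) -> R -> Y) (Sop : (R -> X) -> R -> X) (m L alpha : R).
Hypothesis I_initial : initial_segment I.
Hypothesis K_neq0 : K !=set0.
Hypothesis K_closed : closed K.
Hypothesis K_convex : convex_set K.
Hypothesis m_gt0 : 0 < m.
Hypothesis L_gt0 : 0 < L.
Hypothesis A_mono : strongly_monotone ipX m A.
Hypothesis A_lip : L.-lipschitz A.
Hypothesis j_convex : forall eta, convex_function K (j eta).
Hypothesis j_lip : forall eta, [lipschitz j eta v | v in K].
Hypothesis alpha_ge0 : 0 <= alpha.
Hypothesis j_cross : cross_lipschitz K alpha j.
Hypothesis Rop_cont : preserves_continuity I Rop.
Hypothesis Sop_cont : preserves_continuity I Sop.
Hypothesis f_cont : {within I, continuous f}.

Definition history_vi_solution (u : R -> X) :=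
  forall t, I t -> subdifferential ipX K (j (Rop u t)) (u t) (f t - Sop u t - A (u t)).

Definition frozen_vi_solver (Lam : (R -> X) -> R -> X) := forall u t,
  subdifferential ipX K (j (Rop u t)) (Lam u t) (f t - Sop u t - A (Lam u t)).

Lemma frozen_vi_solver_exists : exists Lam, frozen_vi_solver Lam.
Proof.
have /choice[sol solP] (p : Y * X) :
    exists w, subdifferential ipX K (j p.1) w (p.2 - A w).
  exact: (vi_exists _ K_neq0 K_closed K_convex (j_convex _) (j_lip _) m_gt0 L_gt0).
exists (fun u t => sol (Rop u t, f t - Sop u t)) => u t.
exact: (solP (Rop u t, f t - Sop u t)).
Qed.

Lemma history_vi_solution_fixedP Lam u : frozen_vi_solver Lam ->
  history_vi_solution u <-> forall t, I t -> Lam u t = u t.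
Proof.
move=> LamP; split=> u_sol t It; last by have := LamP u t; rewrite u_sol.
exact: vi_unique m_gt0 A_mono (LamP u t) (u_sol t It).
Qed.

Lemma frozen_vi_solver_dominated Lam u v s t : frozen_vi_solver Lam ->
  `|Lam u s - Lam v t| <=
    alpha / m * `|Rop u s - Rop v t| + m^-1 * `|f s - Sop u s - (f t - Sop v t)|.
Proof.
move=> LamP.
have := vi_parameter_stability A_mono alpha_ge0 j_cross (LamP u s) (LamP v t).
by rewrite mulrC -ler_pdivlMr// mulrDl mulrAC (mulrC m^-1).
Qed.

Lemma frozen_vi_solver_preserves_continuity Lam :
  frozen_vi_solver Lam -> preserves_continuity I Lam.
Proof.
move=> LamP u u_cont; apply: (within_continuous_dominated (Rop_cont u_cont)
  (within_continuousB f_cont (Sop_cont u_cont))) => s t _ _.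
exact: frozen_vi_solver_dominated.
Qed.

Lemma frozen_vi_solver_history_dependent Lam (J : set R) (lR LR lS LS : R) :
  frozen_vi_solver Lam -> 0 <= LR -> 0 <= LS ->
  almost_history_dependent I J lR LR Rop -> almost_history_dependent I J lS LS Sop ->
  almost_history_dependent I J
    (alpha / m * lR + m^-1 * lS) (alpha / m * LR + m^-1 * LS) Lam.
Proof.
move=> LamP LR_ge0 LS_ge0 R_hist S_hist.
apply: almost_history_dependent_dominated R_hist S_hist _ => //.
- by rewrite divr_ge0// ltW.
- by rewrite invr_ge0 ltW.
- move=> u v t _; apply: le_trans (frozen_vi_solver_dominated u v t t LamP) _.
  by rewrite opprB (addrC (f t - _)) addrA subrK (distrC (Sop v t)).
Qed.

Hypothesis history : forall b, I b -> exists lR LR lS LS : R,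
  [/\ [/\ 0 <= lR, 0 <= LR, 0 <= lS & 0 <= LS], alpha * lR + lS < m,
      almost_history_dependent I `[0, b] lR LR Rop &
      almost_history_dependent I `[0, b] lS LS Sop].

Theorem history_vi_exists_unique : exists u,
  [/\ {within I, continuous u}, history_vi_solution u &
      forall v, {within I, continuous v} -> history_vi_solution v ->
        forall t, I t -> v t = u t].
Proof.
have [Lam LamP] := frozen_vi_solver_exists.
have Lam_hist b : I b -> exists l L : R,
    [/\ 0 <= l < 1, 0 <= L & almost_history_dependent I `[0, b] l L Lam].
  move=> Ib; have [lR [LR [lS [LS [[lR_ge0 LR_ge0 lS_ge0 LS_ge0] small R_hist S_hist]]]]] :=
    history Ib.
  have m_ge0 := ltW m_gt0.
  exists (alpha / m * lR + m^-1 * lS), (alpha / m * LR + m^-1 * LS); split.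
  - rewrite addr_ge0 ?mulr_ge0 ?invr_ge0//=.
    by rewrite mulrAC (mulrC m^-1) -mulrDl ltr_pdivrMr// mul1r.
  - by rewrite addr_ge0 ?mulr_ge0 ?invr_ge0.
  - exact: frozen_vi_solver_history_dependent.
have [u [u_cont u_fixed u_unique]] := history_dependent_fixed_point I_initial
  (frozen_vi_solver_preserves_continuity LamP) Lam_hist.
exists u; split=> // [|v v_cont /(history_vi_solution_fixedP _ LamP) v_fixed].
  exact/(history_vi_solution_fixedP _ LamP).
exact: u_unique.
Qed.

End HistoryDependentVariationalInequality.

Theorem theorem3p1 (R : realType) (X Y : completeNormedModType R)
  (ipX : inner_product X) (ipY : inner_product Y)
  (I : set R) (K : set X) (A : X -> X)
  (Rop : (R -> X) -> R -> Y) (Sop : (R -> X) -> R -> X)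
  (j : Y -> X -> R) (f : R -> X) (mA LA alphaj : R)
  (lR LR lS LS : set R -> R) :
  (* I = [0,T] with T > 0, or I = R_+ *)
  ((exists T : R, 0 < T /\ I = `[0, T]%classic) \/ I = `[0, +oo[%classic) ->
  (* (K) *)
  closed_convex_cone K ->
  (* (A) *)
  0 < mA -> 0 < LA ->
  (forall u v, mA * `|u - v| ^+ 2 <= ipX (A u - A v) (u - v)) ->
  (forall u v, `|A u - A v| <= LA * `|u - v|) ->
  (* (R) *)
  (forall u, {within I, continuous u} -> {within I, continuous (Rop u)}) ->
  (forall J : set R, compact J -> J `<=` I ->
     [/\ 0 < lR J, 0 < LR J &
       forall u1 u2, {within I, continuous u1} -> {within I, continuous u2} ->
       forall t, J t ->
         ((`|Rop u1 t - Rop u2 t|%R)%:E <=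
          (lR J * `|u1 t - u2 t|)%R%:E + (LR J)%:E * @int0 R (fun s : R => `|u1 s - u2 s|%R) t)%E]) ->
  (* (S) *)
  (forall u, {within I, continuous u} -> {within I, continuous (Sop u)}) ->
  (forall J : set R, compact J -> J `<=` I ->
     [/\ 0 < lS J, 0 < LS J &
       forall u1 u2, {within I, continuous u1} -> {within I, continuous u2} ->
       forall t, J t ->
         ((`|Sop u1 t - Sop u2 t|%R)%:E <=
          (lS J * `|u1 t - u2 t|)%R%:E + (LS J)%:E * @int0 R (fun s : R => `|u1 s - u2 s|%R) t)%E]) ->
  (* (j)(a) *)
  (forall eta : Y,
     [/\ (forall (a : R) v1 v2, 0 <= a <= 1 -> K v1 -> K v2 ->
            j eta (a *: v1 + (1 - a) *: v2) <= a * j eta v1 + (1 - a) * j eta v2),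
         (forall (a : R) v, 0 < a -> K v -> j eta (a *: v) = a * j eta v) &
         (exists Lj : R, forall v1 v2, K v1 -> K v2 ->
            `|j eta v1 - j eta v2| <= Lj * `|v1 - v2|)]) ->
  (* (j)(b) *)
  0 <= alphaj ->
  (forall (eta1 eta2 : Y) (v1 v2 : X), K v1 -> K v2 ->
     j eta1 v2 - j eta1 v1 + j eta2 v1 - j eta2 v2
       <= alphaj * `|eta1 - eta2| * `|v1 - v2|) ->
  (* (f) *)
  {within I, continuous f} ->
  (* smallness condition *)
  (forall J : set R, compact J -> J `<=` I -> (alphaj + 1) * (lR J + lS J) < mA) ->
  exists u : R -> X,
    [/\ {within I, continuous u},
        (forall t, I t -> K (u t)),
        (forall t, I t ->
           normal_cone ipX (Cset_t ipX K j f (Rop u t) t) (A (u t) + Sop u t) (- u t))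
      & (forall v : R -> X, {within I, continuous v} ->
           (forall t, I t ->
              normal_cone ipX (Cset_t ipX K j f (Rop v t) t) (A (v t) + Sop v t) (- v t)) ->
           forall t, I t -> v t = u t)].
Proof.
move=> I_itv K_cone mA_gt0 LA_gt0 A_mono A_lip Rop_cont Rop_hist Sop_cont Sop_hist j_props.
move=> alphaj_ge0 j_cross f_cont small; have [K_neq0 K_closed K_convex _] := K_cone.
have I_initial : initial_segment I.
  by case: I_itv => [[T [_ ->]]| ->]; [exact: initial_segment_itv|exact: initial_segment_itvcy].
have j_convex eta : convex_function K (j eta) by apply/convex_functionP; case: (j_props eta).
have j_lip eta : [lipschitz j eta v | v in K].
  by apply/lipschitzP; have [_ _ [Lj]] := j_props eta; exists Lj; exact/klipschitzP.
have normal_coneP u t : normal_cone ipX (Cset_t ipX K j f (Rop u t) t) (A (u t) + Sop u t)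
    (- u t) <-> subdifferential ipX K (j (Rop u t)) (u t) (f t - Sop u t - A (u t)).
  by apply: normal_cone_Cset_tP => //; case: (j_props (Rop u t)).
have [||b Ib|u [u_cont u_sol u_unique]] := history_vi_exists_unique I_initial K_neq0 K_closed
    _ mA_gt0 LA_gt0 A_mono _ j_convex j_lip alphaj_ge0 j_cross Rop_cont Sop_cont f_cont.
- exact/convex_setP.
- by apply/klipschitzP => u v _ _; exact: A_lip.
- pose J : set R := `[0, b]%classic.
  have J_compact : compact J := @segment_compact R 0 b; have J_sub := (I_initial b Ib).2.
  have [lR_gt0 LR_gt0 R_hist] := Rop_hist J J_compact J_sub.
  have [lS_gt0 LS_gt0 S_hist] := Sop_hist J J_compact J_sub.
  exists (lR J), (LR J), (lS J), (LS J); split=> //; first by split; exact: ltW.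
  apply: le_lt_trans (small J J_compact J_sub).
  by have := mulr_ge0 alphaj_ge0 (ltW lS_gt0); lra.
- exists u; split=> // [t It|t It|v v_cont v_sol]; first by case: (u_sol t It).
    exact/normal_coneP/u_sol.
  by apply: u_unique => // t It; apply/normal_coneP/v_sol.
Qed.
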